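(* Every symmetric anti-Leibniz algebra over $\mathbb{C}$ is a central extension of a suitable Jacobi-Jordan algebra; that is, for every symmetric anti-Leibniz algebra $L$ there is an ideal $A\subseteq \mathrm{Ann}(L)$ such that $L/A$ is a Jacobi-Jordan algebra.
   Context: An algebra means a complex vector space with a bilinear multiplication, not assumed associative. A right anti-Leibniz algebra satisfies $(xy)z=-(xz)y-x(yz)$; a left anti-Leibniz algebra satisfies $x(yz)=-(xy)z-y(xz)$. A symmetric anti-Leibniz algebra is an algebra that is both left and right anti-Leibniz. A Jacobi-Jordan (mock-Lie) algebra is a commutative algebra satisfying $(xy)z+(yz)x+(zx)y=0$. The annihilator is $\mathrm{Ann}(L)=\{a\in L: aL=La=0\}$. An algebra $L$ is a central extension of an algebra $B$ if there is a surjective homomorphism $L\to B$ whose kernel is contained in $\mathrm{Ann}(L)$. *)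

(* Defs.v *)
From HB Require Import structures.
From mathcomp Require Import all_boot all_order all_algebra.
From mathcomp Require Import generic_quotient ring_quotient sesquilinear.
From mathcomp Require Import complex classical_sets reals.

Set Implicit Arguments.
Unset Strict Implicit.
Unset Printing Implicit Defensive.

Import GRing.Theory.
Import Quotient.
Local Open Scope ring_scope.
Local Open Scope quotient_scope.
Local Open Scope classical_set_scope.

(* The multiplication is neither associative nor unital, and the underlying
   vector space may be infinite dimensional. *)
Record algebra (K : fieldType) := MkAlgebra {
  alg_space :> lmodType K;
  alg_mul : {bilinear alg_space -> alg_space -> alg_space}
}.

Local Notation "x ** y" := (alg_mul _ x y) (at level 40, left associativity).

Section Varieties.
Variables (K : fieldType) (L : algebra K).
Implicit Types x y z : L.

Definition right_anti_leibniz : Prop :=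
  forall x y z, (x ** y) ** z = - ((x ** z) ** y) - x ** (y ** z).

Definition left_anti_leibniz : Prop :=
  forall x y z, x ** (y ** z) = - ((x ** y) ** z) - y ** (x ** z).

Definition symmetric_anti_leibniz : Prop :=
  left_anti_leibniz /\ right_anti_leibniz.

Definition jacobi_jordan : Prop :=
  (forall x y, x ** y = y ** x) /\
  (forall x y z, (x ** y) ** z + (y ** z) ** x + (z ** x) ** y = 0).

Definition annihilator : set L :=
  [set a | forall x, a ** x = 0 /\ x ** a = 0].

End Varieties.

Arguments annihilator {K} L.

Definition central_extension (K : fieldType) (L B : algebra K) : Prop :=
  exists f : {linear L -> B},
    [/\ forall x y : L, f (x ** y) = f x ** f y,
        forall b, exists x, f x = b
      & [set x | f x = 0] `<=` annihilator L].

(* The predicate is boolean because the quotient construction requires it;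
   classically this is no restriction. *)
Record ideal (K : fieldType) (L : algebra K) := Ideal {
  ideal_pred :> {pred L};
  ideal_submod : submod_closed ideal_pred;
  ideal_mulr : forall a x, a \in ideal_pred -> a ** x \in ideal_pred;
  ideal_mull : forall x a, a \in ideal_pred -> x ** a \in ideal_pred
}.

HB.instance Definition _ (K : fieldType) (L : algebra K) (A : ideal L) :=
  GRing.isSubmodClosed.Build K L (ideal_pred A) (ideal_submod A).

Section Quotient.
Variables (K : fieldType) (L : algebra K) (A : ideal L).

Definition quot_space : Type := {quot (ideal_pred A)}.

HB.instance Definition _ := GRing.Zmodule.on quot_space.
HB.instance Definition _ := EqQuotient.on quot_space.

Definition quot_pi (x : L) : quot_space := \pi_quot_space x.

Lemma quot_pi_eq x y : (quot_pi x = quot_pi y) <-> x - y \in A.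
Proof. by rewrite /quot_pi idealrBE; split=> [->|/eqP]. Qed.

Lemma quot_reprK (q : quot_space) : quot_pi (repr q) = q.
Proof. exact: reprK. Qed.

Lemma quot_piD x y : quot_pi (x + y) = quot_pi x + quot_pi y.
Proof. exact: (@pi_addr _ _ _ _ _ {quot (ideal_pred A)}). Qed.

Lemma quot_piB x y : quot_pi (x - y) = quot_pi x - quot_pi y.
Proof. by apply/(addIr (quot_pi y)); rewrite -quot_piD !subrK. Qed.

Lemma quot_pi0 : quot_pi 0 = 0.
Proof. by have := quot_piB 0 0; rewrite !subrr. Qed.

Definition quot_scale (c : K) (q : quot_space) : quot_space :=
  \pi_quot_space (c *: repr q).

Lemma quot_scaleE c x : quot_scale c (quot_pi x) = quot_pi (c *: x).
Proof.
by apply/quot_pi_eq; rewrite -scalerBr rpredZ //; apply/quot_pi_eq;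
  rewrite quot_reprK.
Qed.

Fact quot_scaleA a b q :
  quot_scale a (quot_scale b q) = quot_scale (a * b) q.
Proof. by rewrite -(quot_reprK q) !quot_scaleE scalerA. Qed.

Fact quot_scale1 : left_id 1 quot_scale.
Proof. by move=> q; rewrite -(quot_reprK q) quot_scaleE scale1r. Qed.

Fact quot_scaleDr : right_distributive quot_scale +%R.
Proof.
move=> c p q; rewrite -(quot_reprK p) -(quot_reprK q) -quot_piD !quot_scaleE.
by rewrite -quot_piD scalerDr.
Qed.

Fact quot_scaleDl q : {morph quot_scale^~ q : a b / a + b}.
Proof.
by move=> a b; rewrite -(quot_reprK q) !quot_scaleE -quot_piD scalerDl.
Qed.

HB.instance Definition _ := GRing.Zmodule_isLmodule.Build K quot_space
  quot_scaleA quot_scale1 quot_scaleDr quot_scaleDl.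

Lemma quot_piZ c x : c *: quot_pi x = quot_pi (c *: x).
Proof. exact: quot_scaleE. Qed.

Definition quot_mul (p q : quot_space) : quot_space :=
  \pi_quot_space (repr p ** repr q).

Lemma quot_mulE x y : quot_mul (quot_pi x) (quot_pi y) = quot_pi (x ** y).
Proof.
have e z : repr (quot_pi z) - z \in A by apply/quot_pi_eq; rewrite quot_reprK.
apply/quot_pi_eq; rewrite -(subrK (x ** repr (quot_pi y)) (_ ** _)) -addrA.
rewrite -linearBl -linearBr.
by apply: rpredD; [apply: ideal_mulr|apply: ideal_mull].
Qed.

Fact quot_mulBl r : zmod_morphism (quot_mul^~ r).
Proof.
move=> p q; rewrite -(quot_reprK p) -(quot_reprK q) -(quot_reprK r).
by rewrite -quot_piB !quot_mulE -quot_piB linearBl.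
Qed.

Fact quot_mulBr p : zmod_morphism (quot_mul p).
Proof.
move=> q r; rewrite -(quot_reprK p) -(quot_reprK q) -(quot_reprK r).
by rewrite -quot_piB !quot_mulE -quot_piB linearBr.
Qed.

Fact quot_mulZl q : scalable_for *:%R (quot_mul^~ q).
Proof.
move=> c p; rewrite -(quot_reprK p) -(quot_reprK q) quot_piZ !quot_mulE quot_piZ.
by rewrite linearZl_LR.
Qed.

Fact quot_mulZr p : scalable_for *:%R (quot_mul p).
Proof.
move=> c q; rewrite -(quot_reprK p) -(quot_reprK q) quot_piZ !quot_mulE quot_piZ.
by rewrite linearZr_LR.
Qed.

HB.instance Definition _ :=
  isBilinear.Build K quot_space quot_space quot_space *:%R *:%R quot_mul
    quot_mulBl quot_mulBr quot_mulZl quot_mulZr.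

Definition quot_algebra : algebra K := @MkAlgebra K quot_space quot_mul.

End Quotient.

(* Main.v *)
Require Import Defs.
From HB Require Import structures.
From mathcomp Require Import all_boot all_order all_algebra.
From mathcomp Require Import sesquilinear.
From mathcomp Require Import complex boolp classical_sets reals.

(** Both anti-Leibniz identities evaluate the same sum (xy)z + x(yz): the right
    one gives -(xz)y, the left one -y(xz). So every product commutes with every
    element ([prod_comm]), and both identities collapse to the single relation
    (xy)z + (xz)y + (yz)x = 0 ([collapsed_identity]). Exchanging y and z swaps
    its first two terms, so its last term is symmetric in y and z:
    (yz)x = (zy)x ([prod_symmetric]). As products commute with x, commutators
    annihilate L on both sides ([commutator_annihilator]); and replacing (xz)y
    by (zx)y turns the collapsed relation into the Jacobi identity, which thus
    holds in L itself ([jacobi_identity]). Hence the whole annihilator is a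
    suitable ideal, and the projection onto the quotient by it is the central
    extension. *)

Import GRing.Theory.
Local Open Scope ring_scope.
Local Open Scope classical_set_scope.

Local Notation "x ** y" := (alg_mul _ x y) (at level 40, left associativity).

Section AntiLeibnizIdentities.
Variables (K : fieldType) (L : algebra K).
Hypothesis hL : symmetric_anti_leibniz L.
Implicit Types x y z : L.

(** The only place where the two anti-Leibniz identities are compared: both
    compute (xz)y + x(zy). *)
Lemma prod_comm x y z : (x ** y) ** z = z ** (x ** y).
Proof.
have [hl hr] := hL.
have e : (x ** z) ** y + x ** (z ** y) = - (z ** (x ** y)).
  by rewrite (hl x z y) addrA addrN add0r.
apply: oppr_inj; rewrite -e (hr x z y).
by rewrite subrK.
Qed.

(** The right identity with x(yz) rewritten as (yz)x by [prod_comm]. *)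
Lemma collapsed_identity x y z :
  (x ** y) ** z + (x ** z) ** y + (y ** z) ** x = 0.
Proof.
have [_ hr] := hL.
by rewrite (hr x y z) -(prod_comm y z x) addrAC subrK addNr.
Qed.

(** The collapsed relations for (z, x, y) and (z, y, x) have the same first two
    terms, in opposite order, so their last terms agree. *)
Lemma prod_symmetric x y z : (x ** y) ** z = (y ** x) ** z.
Proof.
have e := collapsed_identity z x y.
rewrite -(collapsed_identity z y x) [X in _ = X + _]addrC in e.
exact: addrI e.
Qed.

Lemma commutator_annihilator x y : annihilator L (x ** y - y ** x).
Proof.
move=> z; rewrite linearBl linearBr /=.
by rewrite -!prod_comm (prod_symmetric x y z) subrr.
Qed.

Lemma jacobi_identity x y z :
  (x ** y) ** z + (y ** z) ** x + (z ** x) ** y = 0.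
Proof. by rewrite (prod_symmetric z x y) addrAC collapsed_identity. Qed.

End AntiLeibnizIdentities.

Section AnnihilatorIdeal.
Variables (K : fieldType) (L : algebra K).

Definition annihilator_pred : {pred L} := fun x => `[< annihilator L x >].

Lemma annihilator_predP x : x \in annihilator_pred <-> annihilator L x.
Proof. by split=> [/asboolP|?]; last exact/asboolP. Qed.

Lemma annihilator_submod : submod_closed annihilator_pred.
Proof.
split=> [|c a b /annihilator_predP ha /annihilator_predP hb];
  apply/annihilator_predP => x; first by rewrite linear0l linear0r.
have [[ax xa] [bx xb]] := (ha x, hb x).
by rewrite linearDl linearDr linearZl_LR linearZr_LR /= ax xa bx xb scaler0 addr0.
Qed.

Lemma annihilator_mulr a x :
  a \in annihilator_pred -> a ** x \in annihilator_pred.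
Proof.
move=> /annihilator_predP ha; apply/annihilator_predP => y.
by rewrite (proj1 (ha x)) linear0l linear0r.
Qed.

Lemma annihilator_mull x a :
  a \in annihilator_pred -> x ** a \in annihilator_pred.
Proof.
move=> /annihilator_predP ha; apply/annihilator_predP => y.
by rewrite (proj2 (ha x)) linear0l linear0r.
Qed.

Definition annihilator_ideal : ideal L :=
  Ideal annihilator_submod annihilator_mulr annihilator_mull.

End AnnihilatorIdeal.

Section Quotients.
Variables (K : fieldType) (L : algebra K) (A : ideal L).

Lemma quot_pi_linear : linear (@quot_pi K L A : L -> quot_algebra A).
Proof. by move=> c x y; rewrite quot_piD -quot_piZ. Qed.

HB.instance Definition _ :=
  GRing.isLinear.Build K L (quot_algebra A) *:%R (@quot_pi K L A)
    quot_pi_linear.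

(** The kernel of the projection is [A], so centrality of the extension is
    exactly centrality of [A]. *)
Lemma quot_central_extension :
  [set x : L | x \in A] `<=` annihilator L ->
  central_extension L (quot_algebra A).
Proof.
move=> hA; exists (@quot_pi K L A : {linear L -> quot_algebra A}).
split=> [x y|b|x /= hx].
- by rewrite /= quot_mulE.
- by exists (repr (b : quot_space A)); exact: quot_reprK.
- apply: hA => /=; rewrite -[x]subr0; apply/quot_pi_eq.
  by rewrite quot_pi0.
Qed.

(** A quotient satisfies the Jacobi-Jordan identities as soon as they hold
    modulo the ideal. *)
Lemma quot_jacobi_jordan :
  (forall x y : L, x ** y - y ** x \in A) ->
  (forall x y z : L,
     (x ** y) ** z + (y ** z) ** x + (z ** x) ** y \in A) ->
  jacobi_jordan (quot_algebra A).
Proof.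
move=> hC hJ; split=> [p q|p q r] /=.
  by rewrite -(quot_reprK p) -(quot_reprK q) !quot_mulE; apply/quot_pi_eq.
rewrite -(quot_reprK p) -(quot_reprK q) -(quot_reprK r) !quot_mulE.
rewrite -!quot_piD -quot_pi0; apply/quot_pi_eq; rewrite subr0; exact: hJ.
Qed.

End Quotients.

Theorem theorem12 (R : realType) (L : algebra R[i])
    (hL : symmetric_anti_leibniz L) :
  (exists B : algebra R[i], jacobi_jordan B /\ central_extension L B) /\
  (exists A : ideal L,
     [set x : L | x \in A] `<=` annihilator L /\ jacobi_jordan (quot_algebra A)).
Proof.
pose A := annihilator_ideal _ L.
have cA : [set x : L | x \in A] `<=` annihilator L.
  by move=> x /annihilator_predP.
have jA : jacobi_jordan (quot_algebra A).
  apply: quot_jacobi_jordan => [x y|x y z].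
    by apply/annihilator_predP; exact: commutator_annihilator.
  by rewrite jacobi_identity // rpred0.
split; last by exists A.
by exists (quot_algebra A); split=> //; exact: quot_central_extension.
Qed.
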